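(* Assume that $2\le N\le M<d+1=N(N+1)/2$. Then $\mathcal{SC}(M,N)$ does not contain interior points. In other words, for the boundary of $\mathcal{SC}(M,N)$ we have $\partial\,\mathcal{SC}(M,N)=\mathcal{SC}(M,N)$.
   Context: Here $d:=(N-1)(N+2)/2$. A frame for $\mathbb{R}^N$ with $M\ge N$ vectors is a family $\{\varphi_k\}_{k=1}^M\subset\mathbb{R}^N$ for which there are constants $A,B>0$ with $A\|x\|^2\le\sum_{k=1}^M|\langle x,\varphi_k\rangle|^2\le B\|x\|^2$ for all $x\in\mathbb{R}^N$; it is tight if one can take $A=B$. $\mathcal{F}(M,N)$ is the set of frames for $\mathbb{R}^N$ with $M$ (ordered) vectors, identified with the set of all real $N\times M$ matrices of rank $N$ (the $k$th column being $\varphi_k$), and equipped with the topology induced by the Euclidean topology of $\mathbb{R}^{N\times M}$. A frame $\{\varphi_k\}_{k=1}^M$ is scalable if there exist nonnegative scalars $c_1,\ldots,c_M$ such that $\{c_k\varphi_k\}_{k=1}^M$ is a tight frame for $\mathbb{R}^N$. $\mathcal{SC}(M,N)$ is the set of scalable frames in $\mathcal{F}(M,N)$. Interior points and the boundary $\partial\,\mathcal{SC}(M,N)$ are understood with respect to the topology of $\mathcal{F}(M,N)$.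
   Formalization: The equality ∂SC(M,N)=SC(M,N) fails when frames may contain zero vectors (e.g. N=3, M=4), so the inclusion ∂SC(M,N)⊆SC(M,N) is stated only for frames with all vectors nonzero; the absence of interior points and SC(M,N)⊆∂SC(M,N) are stated in full. *)

(* Defs.v *)
From HB Require Import structures.
From mathcomp Require Import all_boot all_order all_algebra.
From mathcomp Require Import all_classical all_reals all_analysis.

Set Implicit Arguments.
Unset Strict Implicit.
Unset Printing Implicit Defensive.

Import Order.TTheory GRing.Theory Num.Theory.
Import numFieldNormedType.Exports.
Local Open Scope classical_set_scope.
Local Open Scope ring_scope.

(* The norm that the library puts on matrices is the sup norm, so Euclidean
   quantities are written with [dot]; both norms induce the same topology. *)
Definition dot (R : realType) (N : nat) (x y : 'cV[R]_N) : R :=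
  \sum_(i < N) x i 0 * y i 0.

Definition has_frame_bounds (R : realType) (N M : nat) (A B : R)
    (phi : 'I_M -> 'cV[R]_N) : Prop :=
  [/\ 0 < A, 0 < B &
    forall x : 'cV[R]_N,
      A * dot x x <= \sum_(k < M) `|dot x (phi k)| ^+ 2 <= B * dot x x].

Definition is_frame (R : realType) (N M : nat) (phi : 'I_M -> 'cV[R]_N) : Prop :=
  exists A B : R, has_frame_bounds A B phi.

Definition is_tight_frame (R : realType) (N M : nat)
    (phi : 'I_M -> 'cV[R]_N) : Prop :=
  exists A : R, has_frame_bounds A A phi.

Definition is_scalable (R : realType) (N M : nat)
    (phi : 'I_M -> 'cV[R]_N) : Prop :=
  exists2 c : 'I_M -> R,
    forall k, 0 <= c k & is_tight_frame (fun k => c k *: phi k).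

Definition frame_of (R : realType) (N M : nat) (Phi : 'M[R]_(N, M)) :
  'I_M -> 'cV[R]_N := fun k => col k Phi.

(* As a type this is [set_type (frames R M N)], which the library equips with
   the topology induced by the inclusion into 'M[R]_(N, M). *)
Definition frames (R : realType) (M N : nat) : set 'M[R]_(N, M) :=
  [set Phi | is_frame (frame_of Phi)].
Arguments frames : clear implicits.

Definition scalable_frames (R : realType) (M N : nat) : set (frames R M N) :=
  [set Phi | is_scalable (frame_of (set_val Phi))].
Arguments scalable_frames : clear implicits.

Definition boundary (T : topologicalType) (A : set T) : set T :=
  closure A `\` A°.

(* Zero vectors are allowed in a frame, and at such frames [scalable_frames] need
   not be closed: for e > 0 the vectors (1,3,0), (1,0,0), (0,0,1), e(1,-3,0) form
   a scalable frame for R^3, but for e = 0 they form a frame that is not scalable.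
   Hence [boundary (scalable_frames R M N)] can equal [scalable_frames R M N] only
   up to frames outside [nonvanishing_frames R M N]. *)
Definition nonvanishing_frames (R : realType) (M N : nat) :
    set (frames R M N) :=
  [set Phi | forall k, frame_of (set_val Phi) k != 0].
Arguments nonvanishing_frames : clear implicits.

(* Main.v *)
(* A frame is scalable iff 1 = sum_k w_k phi_k phi_k^T for some weights w_k >= 0.
   The squares y y^T with y in a ball span the space of symmetric matrices, of
   dimension N(N+1)/2 > M; so the vectors of a frame can be perturbed one at a
   time until 1, phi_1 phi_1^T, ..., phi_M phi_M^T are linearly independent, and
   then the frame is not scalable. Conversely, near a frame without zero vectors
   the weights of scalable frames are bounded, so a limit of scalable frames is
   scalable by compactness. *)
Require Import Defs.
From HB Require Import structures.
From mathcomp Require Import all_boot all_order all_algebra.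
From mathcomp Require Import all_classical all_reals all_analysis.
From mathcomp Require Import ring lra zify.

Set Implicit Arguments.
Unset Strict Implicit.
Unset Printing Implicit Defensive.

Import Order.TTheory GRing.Theory Num.Theory.
Import numFieldNormedType.Exports.
Local Open Scope classical_set_scope.
Local Open Scope ring_scope.

(** * Inner products and scalability as a matrix identity *)

Lemma dotE (R : realType) (N : nat) (x y : 'cV[R]_N) :
  dot x y = (x^T *m y) 0 0.
Proof. by rewrite !mxE; apply: eq_bigr => i _; rewrite mxE. Qed.

Lemma dotDr (R : realType) (N : nat) (x y z : 'cV[R]_N) :
  dot x (y + z) = dot x y + dot x z.
Proof. by rewrite !dotE mulmxDr mxE. Qed.

Lemma dotDl (R : realType) (N : nat) (x y z : 'cV[R]_N) :
  dot (x + y) z = dot x z + dot y z.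
Proof. by rewrite !dotE linearD /= mulmxDl mxE. Qed.

Lemma dotZr (R : realType) (N : nat) (a : R) (x y : 'cV[R]_N) :
  dot x (a *: y) = a * dot x y.
Proof. by rewrite !dotE -scalemxAr mxE. Qed.

Lemma dotC (R : realType) (N : nat) (x y : 'cV[R]_N) : dot x y = dot y x.
Proof. by apply: eq_bigr => i _; rewrite mulrC. Qed.

Lemma dot_ge0 (R : realType) (N : nat) (x : 'cV[R]_N) : 0 <= dot x x.
Proof. by apply: sumr_ge0 => i _; rewrite -expr2 sqr_ge0. Qed.

Lemma dot_delta_mul (R : realType) (N : nat) (S : 'M[R]_N) (i j : 'I_N) :
  dot (delta_mx i 0) (S *m delta_mx j 0) = S i j.
Proof. by rewrite dotE trmx_delta -rowE -colE !mxE. Qed.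

(** Polarization: the quadratic form at [x + y] determines the bilinear form, because symmetry of
    [S] makes the two cross terms equal; basis vectors then read off the entries. *)
Lemma sym_scalar_form (R : realType) (N : nat) (A : R) (S : 'M[R]_N) :
  S^T = S -> (forall x, dot x (S *m x) = A * dot x x) -> S = A%:M.
Proof.
move=> Ssym Sx; apply/matrixP => i j.
have Sb x y : dot x (S *m y) = A * dot x y.
  have SC : dot y (S *m x) = dot x (S *m y).
    by rewrite dotC !dotE trmx_mul Ssym mulmxA.
  have := Sx (x + y).
  rewrite mulmxDr !dotDl !dotDr SC !Sx (dotC y x) => h.
  lra.
rewrite -dot_delta_mul Sb.
by rewrite -[delta_mx j 0 in LHS]mul1mx dot_delta_mul !mxE mulr_natr.
Qed.

Lemma sum_sqr_dotE (R : realType) (N M : nat) (c : 'I_M -> R)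
    (phi : 'I_M -> 'cV[R]_N) (x : 'cV[R]_N) :
  \sum_k `|dot x (c k *: phi k)| ^+ 2 =
  dot x ((\sum_k c k ^+ 2 *: (phi k *m (phi k)^T)) *m x).
Proof.
rewrite dotE mulmx_suml mulmx_sumr summxE; apply: eq_bigr => k _.
rewrite real_normK ?num_real// dotZr exprMn -scalemxAl -scalemxAr mxE.
congr (_ * _); rewrite -mulmxA (mulmxA x^T) [RHS]mxE big_ord1 -!dotE.
by rewrite (dotC (phi k)) expr2.
Qed.

(** For the scaled vectors the frame operator has weights [c k ^+ 2] and equals [A%:M]; dividing by
    [A] gives [w]. Conversely, square roots of the weights give a tight frame with bound 1. *)
Lemma is_scalableP (R : realType) (N M : nat) (phi : 'I_M -> 'cV[R]_N) :
  is_scalable phi <->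
  exists2 w : 'I_M -> R, forall k, 0 <= w k &
    \sum_k w k *: (phi k *m (phi k)^T) = 1%:M.
Proof.
split=> [[c c0 [A [A0 _ cA]]]|[w w0 wE]].
  exists (fun k => c k ^+ 2 / A) => [k|]; first by rewrite divr_ge0 ?sqr_ge0 ?ltW.
  under eq_bigr do rewrite mulrC -scalerA.
  rewrite -scaler_sumr (sym_scalar_form (A := A) (S := \sum_k _)).
  - by rewrite scale_scalar_mx mulVf ?gt_eqF.
  - rewrite linear_sum; apply: eq_bigr => k _ /=.
    by rewrite linearZ /= trmx_mul trmxK.
  - by move=> x; rewrite -sum_sqr_dotE; apply/eqP; rewrite eq_sym eq_le.
exists (fun k => Num.sqrt (w k)) => [k|]; first exact: sqrtr_ge0.
exists 1; split=> // x; rewrite sum_sqr_dotE.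
under eq_bigr do rewrite sqr_sqrtr//.
by rewrite wE mul1mx mul1r lexx.
Qed.

(** * Openness of the set of frames *)

(** Cauchy-Schwarz against the all-ones vector, obtained from the pairwise bound of [a i * a j] by
    the mean of the squares. *)
Lemma sqr_sum_le (R : realType) (n : nat) (a : 'I_n -> R) :
  (\sum_i a i) ^+ 2 <= n%:R * \sum_i a i ^+ 2.
Proof.
rewrite expr2 big_distrlr /=.
apply: (@le_trans _ _ (\sum_i \sum_j (a i ^+ 2 / 2 + a j ^+ 2 / 2))).
  apply: ler_sum => i _; apply: ler_sum => j _.
  by have := sqr_ge0 (a i - a j); nra.
under [leLHS]eq_bigr => i _ do rewrite big_split /= sumr_const card_ord.
rewrite big_split /= sumr_const card_ord sumrMnl -!mulr_suml.
by rewrite -mulrnDl -splitr mulr_natl.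
Qed.

Lemma sqr_dot_le (R : realType) (N : nat) (K : R) (x y : 'cV[R]_N) :
  (forall i, `|y i 0| <= K) -> dot x y ^+ 2 <= N%:R * K ^+ 2 * dot x x.
Proof.
move=> yK; apply: (le_trans (sqr_sum_le _)).
rewrite -mulrA ler_wpM2l// mulr_sumr; apply: ler_sum => i _.
rewrite exprMn mulrC -expr2 ler_wpM2r ?sqr_ge0//.
by rewrite -real_normK ?num_real// ler_pXn2r// nnegrE ?(le_trans _ (yK i)).
Qed.

Lemma nbhs_mxP (R : realType) (m n : nat) (A : 'M[R]_(m, n))
    (P : set 'M[R]_(m, n)) :
  nbhs A P <-> exists2 e, 0 < e &
    forall B : 'M[R]_(m, n), (forall i j, `|B i j - A i j| < e) -> P B.
Proof.
split=> [/nbhs_ballP[e /= e0 eP]|[e e0 eP]].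
  exists e => // B BA; apply: eP; split=> // i j.
  by rewrite /ball/= distrC.
apply/nbhs_ballP; exists e => //= B [_ BA]; apply: eP => i j.
by rewrite distrC; apply: BA.
Qed.

(** This guarantees that a small perturbation of a frame is again a point of the space
    [frames R M N]. *)
Lemma near_is_frame (R : realType) (N M : nat) (Phi : 'M[R]_(N, M)) :
  is_frame (frame_of Phi) -> \forall Psi \near Phi, is_frame (frame_of Psi).
Proof.
move=> [A [B [A0 B0 AB]]].
(* Entries moved by at most the square root of [A / C] change the M analysis coefficients by a total
   square of at most M N (A / C) [dot x x], which is below A/4 times [dot x x]; the summand 1 keeps
   [C] positive. *)
pose C : R := 4 * (M%:R * N%:R + 1).
have C0 : 0 < C by rewrite mulr_gt0// ltr_wpDl// mulr_ge0.
have AC0 : 0 < A / C by rewrite divr_gt0.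
apply/nbhs_mxP; exists (Num.sqrt (A / C)); first by rewrite sqrtr_gt0.
move=> Psi PsiPhi; exists (A / 4), (2 * B + A); split; [lra|lra|] => x.
have {AB}/andP[lo hi] := AB x.
set T := \sum_k _ in lo hi; set T' := \sum_k _.
pose E := \sum_k dot x (frame_of Psi k - frame_of Phi k) ^+ 2.
have hE : E <= A / 4 * dot x x.
  apply: (@le_trans _ _ (\sum_(k < M) N%:R * (A / C) * dot x x)).
    apply: ler_sum => k _; rewrite -[A / C]sqr_sqrtr ?(ltW AC0)//.
    by apply: sqr_dot_le => i; rewrite !mxE ltW// PsiPhi.
  rewrite sumr_const card_ord -[leLHS]mulr_natl !mulrA ler_wpM2r ?dot_ge0//.
  rewrite [_ * N%:R * A]mulrC -mulrA ler_wpM2l ?(ltW A0)// ler_pdivrMr// /C.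
  have : (0 : R) <= M%:R * N%:R by rewrite mulr_ge0.
  lra.
have diff k : dot x (frame_of Psi k - frame_of Phi k) =
    dot x (frame_of Psi k) - dot x (frame_of Phi k).
  by rewrite dotDr -scaleN1r dotZr mulN1r.
(* With a, b the coefficients for [Phi], [Psi], the gap 2b^2 + 2(b - a)^2 - a^2 is the square of 2b
   - a; [h2] is the mirror image. *)
have h1 : T <= 2 * T' + 2 * E.
  rewrite !mulr_sumr -big_split /=; apply: ler_sum => k _.
  rewrite !real_normK ?num_real// diff.
  have := sqr_ge0 (2 * dot x (frame_of Psi k) - dot x (frame_of Phi k)).
  nra.
have h2 : T' <= 2 * T + 2 * E.
  rewrite !mulr_sumr -big_split /=; apply: ler_sum => k _.
  rewrite !real_normK ?num_real// diff.
  have := sqr_ge0 (dot x (frame_of Psi k) - 2 * dot x (frame_of Phi k)).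
  nra.
by have d0 := dot_ge0 x; apply/andP; split; nra.
Qed.

(** * Squares of vectors span the symmetric matrices *)

Definition upper_index (N : nat) : {set 'I_N * 'I_N} :=
  [set p : 'I_N * 'I_N | (p.1 <= p.2)%N].

Lemma card_upper_index (N : nat) : (#|upper_index N| * 2 = N * N.+1)%N.
Proof.
have -> : #|upper_index N| = (\sum_(j < N) j.+1)%N.
  rewrite -sum1_card (eq_bigl (fun p : 'I_N * 'I_N => p.1 <= p.2)%N); last first.
    by move=> p; rewrite inE.
  rewrite -(pair_big_dep xpredT (fun i j : 'I_N => (i <= j)%N) (fun _ _ => 1%N)) /=.
  rewrite (exchange_big_dep xpredT) //=; apply: eq_bigr => j _.
  rewrite -(big_mkord (fun i => i <= j)%N (fun _ => 1%N)).
  rewrite (big_cat_nat _ (n := j.+1)) //= [X in (_ + X)%N]big_nat_cond.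
  rewrite [X in (_ + X)%N]big_pred0.
    rewrite addn0 big_nat_cond (eq_bigl (fun i => 0 <= i < j.+1)%N).
      by rewrite -big_nat sum_nat_const_nat subn0 muln1.
    by move=> i; rewrite ltnS leq0n /= andbb.
  by move=> i; case: leqP => //=; rewrite andbF.
elim: N => [|N IH]; first by rewrite big_ord0.
by rewrite big_ord_recr /= mulnDl IH; lia.
Qed.

(** Coordinates on the symmetric matrices: the target has dimension exactly N(N+1)/2, and
    below-diagonal entries are forgotten. *)
Definition upper (R : realType) (N : nat) (S : 'M[R]_N) :
    'rV[R]_#|upper_index N| :=
  \row_k S (enum_val k).1 (enum_val k).2.

Lemma upper_linear (R : realType) (N : nat) : linear (@upper R N).
Proof. by move=> a S T; apply/rowP => k; rewrite !mxE. Qed.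

HB.instance Definition _ (R : realType) (N : nat) :=
  GRing.isLinear.Build R _ _ _ (@upper R N) (@upper_linear R N).

Definition outer_square (R : realType) (N : nat) (x : 'cV[R]_N) :=
  upper (x *m x^T).

(* The second difference of x |-> x x^T in the direction y is 2 y y^T, so a
   subspace containing all squares near x contains every square. *)
Lemma outer_square_span_ball (R : realType) (N : nat)
    (U : {vspace 'rV[R]_#|upper_index N|}) (x : 'cV[R]_N) (e : R) :
  0 < e ->
  (forall y : 'cV[R]_N, (forall i, `|y i 0 - x i 0| < e) -> outer_square y \in U) ->
  forall y, outer_square y \in U.
Proof.
move=> e0 xU y.
(* [K] strictly dominates every entry of [y], so moving by [e / K] along [y] stays within [e] of
   [x]. *)
pose K := 1 + \sum_i `|y i 0|.
have K0 : 0 < K by rewrite ltr_pwDl// sumr_ge0.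
have yK i : `|y i 0| < K.
  by rewrite /K (bigD1 i)//= addrCA ltrDl ltr_pwDl// sumr_ge0.
pose t := e / K.
have t0 : 0 < t by rewrite divr_gt0.
have near_x s : `|s| = t -> outer_square (x + s *: y) \in U.
  move=> st; apply: xU => i; rewrite !mxE [x i 0 + _]addrC addrK normrM st /t.
  by rewrite mulrAC ltr_pdivrMr// ltr_pM2l.
have xxU : outer_square x \in U.
  by apply: xU => i; rewrite subrr normr0.
have -> : outer_square y = (2 * t ^+ 2)^-1 *:
    (outer_square (x + t *: y) + outer_square (x + (- t) *: y)
     - (2 : R) *: outer_square x).
  apply/rowP => k; rewrite !mxE !big_ord1 !mxE; field.
  by rewrite gt_eqF.
by rewrite rpredZ// rpredB ?rpredD ?rpredZ ?near_x ?normrN// gtr0_norm.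
Qed.

(** Each coordinate vector is the image of e_i e_i^T or, off the diagonal, of the polarized square
    e_i e_j^T + e_j e_i^T. *)
Lemma outer_square_span (R : realType) (N : nat)
    (U : {vspace 'rV[R]_#|upper_index N|}) :
  (forall y, outer_square y \in U) -> U = fullv.
Proof.
move=> sqU; apply/eqP; rewrite eqEsubv subvf /=; apply/subvP => v _.
rewrite [v]row_sum_delta; apply: memv_suml => k _; apply: rpredZ.
have := enum_valP k; rewrite inE.
case def_p : (enum_val k) => [i j] /= leij.
have deltaE (S : 'M[R]_N) :
    (forall a b : 'I_N, (a <= b)%N -> S a b = ((a == i) && (b == j))%:R) ->
    delta_mx 0 k = upper S.
  move=> SE; apply/rowP => l; rewrite !mxE eqxx /= SE.
    by rewrite -(inj_eq enum_val_inj) def_p; case: (enum_val l).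
  by have := enum_valP l; rewrite inE.
pose e l : 'cV[R]_N := delta_mx l 0.
have [eij|neij] := eqVneq i j.
  rewrite (deltaE (e i *m (e i)^T)); first exact: sqU.
  move=> a b _; rewrite !mxE big_ord1 !mxE !eqxx !andbT -eij.
  by case: (a == i); case: (b == i); rewrite ?mulr0 ?mul0r ?mulr1.
rewrite (deltaE ((e i + e j) *m (e i + e j)^T - e i *m (e i)^T - e j *m (e j)^T)).
  by rewrite !linearB /= !rpredB// sqU.
move=> a b leab; rewrite !mxE !big_ord1 !mxE !eqxx !andbT.
(* Since i < j and a <= b, the transposed entry e_j e_i^T is invisible to [upper]. *)
have : (a == j) && (b == i) = false.
  apply/negP => /andP[/eqP aj /eqP bi]; move: neij; rewrite -val_eqE eqn_leq leij /=.
  by rewrite -aj -bi leab.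
case: (a == i); case: (b == j); case: (a == j); case: (b == i) => //= _; ring.
Qed.

(** * Perturbation to frames that are not scalable *)

Lemma free_outer_squares_dense (R : realType) (N : nat) (e : R)
    (X : seq 'rV[R]_#|upper_index N|) (s : seq 'cV[R]_N) :
  0 < e -> free X -> (size X + size s <= #|upper_index N|)%N ->
  exists t : seq 'cV[R]_N,
    [/\ size t = size s,
      forall k i, (k < size s)%N -> `|(nth 0 t k) i 0 - (nth 0 s k) i 0| < e &
      free (map (@outer_square R N) t ++ X)].
Proof.
move=> e0 freeX; elim: s => [|x s IH] /= szD; first by exists [::].
have {IH}[|t [szt ts freet]] := IH; first by rewrite (leq_trans _ szD)// leq_add2l.
pose U := <<map (@outer_square R N) t ++ X>>%VS.
have [y yx yU] : exists2 y : 'cV[R]_N,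
    forall i, `|y i 0 - x i 0| < e & outer_square y \notin U.
  apply: contrapT => noy.
  have sqU : forall y, outer_square y \in U.
    apply: (@outer_square_span_ball _ _ U x e e0) => y yx.
    by apply: contrapT => yU; apply: noy; exists y => //; apply/negP.
  (* If all nearby squares lay in [U], then [U] would be the full space, yet it is spanned by fewer
     vectors than its dimension. *)
  have := dim_span (map (@outer_square R N) t ++ X).
  rewrite -/U (outer_square_span sqU) dimvf dim_matrix mul1r.
  by rewrite size_cat size_map szt leqNgt addnC -addnS szD.
exists (y :: t); split=> /=; first by rewrite szt.
  by case=> [|k] i //= ks; apply: ts.
by rewrite free_cons yU.
Qed.

Lemma unscalable_dense (R : realType) (N M : nat) (Phi : 'M[R]_(N, M))
    (e : R) : (0 < N)%N -> (M < #|upper_index N|)%N -> 0 < e ->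
  exists2 Psi : 'M[R]_(N, M), forall i j, `|Psi i j - Phi i j| < e &
    ~ is_scalable (frame_of Psi).
Proof.
move=> N0 MD e0.
have free1 : free [:: upper (1%:M : 'M[R]_N)].
  rewrite seq1_free; apply/negP => /eqP/rowP h.
  have p0 : (Ordinal N0, Ordinal N0) \in upper_index N by rewrite inE /=.
  have := h (enum_rank_in p0 (Ordinal N0, Ordinal N0)).
  rewrite !mxE enum_rankK_in// eqxx => /eqP.
  by rewrite oner_eq0.
pose s := [seq col k Phi | k <- enum 'I_M].
have szs : size s = M by rewrite size_map size_enum_ord.
have [|t [szt ts freet]] := free_outer_squares_dense (s := s) e0 free1.
  by rewrite szs.
pose Psi : 'M[R]_(N, M) := \matrix_(i, k) (nth 0 t k) i 0.
exists Psi => [i k|].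
  rewrite mxE; have := ts k i; rewrite szs ltn_ord => /(_ isT).
  by rewrite (nth_map k) ?size_enum_ord ?nth_ord_enum// mxE.
move=> /is_scalableP[w _ wE].
(* With the identity moved to the head, freeness puts it outside the span of the squares, while [wE]
   puts it inside. *)
have /perm_free := permEl (perm_catC (map (@outer_square R N) t) [:: upper 1%:M]).
rewrite freet => /esym.
rewrite free_cons => /andP[/negP + _]; apply.
rewrite -wE linear_sum; apply: memv_suml => k _.
rewrite linearZ /= rpredZ// memv_span//.
apply/mapP; exists (nth 0 t k); first by rewrite mem_nth// szt szs.
rewrite /outer_square; by congr (upper (_ *m _^T)); apply/colP => i; rewrite !mxE.
Qed.

(** A neighbourhood in the induced topology is the trace of an open [W]; a perturbation chosen
    inside [W] and among the frames contradicts interiority. *)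
Lemma scalable_no_interior (R : realType) (N M : nat) :
  (0 < N)%N -> (M < #|upper_index N|)%N ->
  (scalable_frames R M N)° = set0.
Proof.
move=> N0 MD; apply/seteqP; split=> // Phi [V [[W oW <-] WPhi] WS].
pose P : 'M[R]_(N, M) := set_val Phi.
have nW : nbhs P W by exact: open_nbhs_nbhs.
have nF : nbhs P [set A | is_frame (frame_of A)].
  exact: (near_is_frame (set_valP Phi)).
have nWF : nbhs P (W `&` [set A | is_frame (frame_of A)]) by exact: filterI.
have /nbhs_mxP[e e0 eW] := nWF.
have [Psi /eW[WPsi fPsi] nPsi] := unscalable_dense P N0 MD e0.
exact: nPsi (WS (SigSub (mem_set fPsi : Psi \in frames R M N)) _).
Qed.

(** * Limits of scalable frames without zero vectors *)

Lemma continuous_sumr (R : realType) (T : topologicalType) (n : nat)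
    (f : 'I_n -> T -> R) :
  (forall i, continuous (f i)) -> continuous (fun x => \sum_i f i x).
Proof. by move=> fc; apply: continuous_big => //; exact: add_continuous. Qed.

(* The weights of the nearby scalable frames stay in a fixed compact box since
   w_k phi_k(i)^2 <= 1 and phi_k(i) is bounded away from 0 for some i. *)
Lemma closure_scalable (R : realType) (N M : nat) (Phi : frames R M N) :
  nonvanishing_frames R M N Phi -> closure (scalable_frames R M N) Phi ->
  scalable_frames R M N Phi.
Proof.
move=> nz clPhi; pose P : 'M[R]_(N, M) := set_val Phi.
have /choice[r rP] : forall k, exists i, P i k != 0.
  move=> k; apply: contrapT => Pk0; have /eqP := nz k; apply.
  apply/colP => i; rewrite !mxE; apply: contrapT => Pik.
  by apply: Pk0; exists i; apply/eqP.
(* Nearby matrices keep at least half of the entry [P (r k) k] in absolute value, hence the factor 4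
   after squaring. *)
pose K k := 4 / P (r k) k ^+ 2.
have K0 k : 0 < K k by rewrite divr_gt0// exprn_even_gt0//= rP.
pose Q (A : 'M[R]_(N, M)) i j (w : 'rV[R]_M) := \sum_k w 0 k * (A i k * A j k).
have QE A (w : 'rV[R]_M) :
    \sum_k w 0 k *: (frame_of A k *m (frame_of A k)^T) = \matrix_(i, j) Q A i j w.
  apply/matrixP => i j; rewrite mxE summxE; apply: eq_bigr => k _.
  by rewrite !mxE big_ord1 !mxE.
(* Entrywise l1 distance from the weighted sum of squares to the identity: a zero of [f] in the box
   [C] is a family of scaling weights for [P]. *)
pose f (w : 'rV[R]_M) : R := \sum_i \sum_j `|Q P i j w - (i == j)%:R|.
pose C := [set w : 'rV[R]_M | forall k, `[0, K k]%classic (w ord0 k)].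
have cC : compact C.
  apply: (@rV_compact R M (fun k => `[0, K k]%classic)) => k.
  exact: segment_compact.
have cf : continuous f.
  apply: continuous_sumr => i; apply: continuous_sumr => j w.
  apply: (@cvg_norm _ _ _ (nbhs w)).
  apply: (@cvgB _ _ _ (nbhs w)); last exact: cvg_cst.
  apply: continuous_sumr => k {}w.
  apply: (@cvgM _ _ (nbhs w)); last exact: cvg_cst.
  exact: coord_continuous.
have fC0 : closure (f @` C) 0.
  move=> B /nbhs_ballP[e /= e0 eB].
  (* [G A] bounds, uniformly over weights in [C], the l1 change of the weighted sum when [P] is
     replaced by [A]; weights scaling [A] thus have [f] at most [G A]. *)
  pose G (A : 'M[R]_(N, M)) : R :=
    \sum_i \sum_j \sum_k K k * `|A i k * A j k - P i k * P j k|.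
  have GP : G P = 0.
    by rewrite /G; do 3![apply: big1 => ? _]; rewrite subrr normr0 mulr0.
  have cG : continuous G.
    do 3!apply: continuous_sumr => ?; move=> A.
    apply: (@cvgM _ _ (nbhs A)); first exact: cvg_cst.
    apply: (@cvg_norm _ _ _ (nbhs A)); apply: (@cvgB _ _ _ (nbhs A)).
      apply: (@cvgM _ _ (nbhs A)); exact: coord_continuous.
    exact: cvg_cst.
  have nG : \forall A \near P, G A < e.
    by apply: (cvgr_lt _ (cG P)); rewrite GP.
  have nr : nbhs P [set A : 'M[R]_(N, M) |
      forall k, `|P (r k) k| / 2 < `|A (r k) k|].
    apply: (@filter_forall _ _ _ (nbhs P)) => k.
    apply: (@cvgr_gt _ _ (nbhs P) _ _ `|P (r k) k|).
      by apply: (@cvg_norm _ _ _ (nbhs P)); exact: coord_continuous.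
    by have := rP k; rewrite -normr_gt0; lra.
  have nGr : nbhs P [set A : 'M[R]_(N, M) |
      G A < e /\ forall k, `|P (r k) k| / 2 < `|A (r k) k|].
    exact: filterI nG nr.
  have [Psi [/is_scalableP[w w0 wE]]] := clPhi _ (initial_continuous nGr).
  set A : 'M[R]_(N, M) := set_val Psi in wE * => -[GA Ar].
  pose v : 'rV[R]_M := \row_k w k.
  have QA i j : Q A i j v = (i == j)%:R.
    have := congr1 (fun S : 'M[R]_N => S i j) wE.
    rewrite [RHS]mxE => <-; rewrite summxE; apply: eq_bigr => k _.
    by rewrite !mxE big_ord1 !mxE.
  have wK k : w k <= K k.
    rewrite /K ler_pdivlMr ?exprn_even_gt0//= ?rP//.
    have Qk : w k * A (r k) k ^+ 2 <= 1.
      apply: (@le_trans _ _ (Q A (r k) (r k) v)); last by rewrite QA eqxx.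
      (* A diagonal entry of the identity is 1 and is a sum of nonnegative terms, so each term is at
         most 1. *)
      rewrite /Q (bigD1 k)//= mxE -expr2 lerDl.
      by rewrite sumr_ge0// => l _; rewrite mxE mulr_ge0// -expr2 sqr_ge0.
    have PA : P (r k) k ^+ 2 <= 4 * A (r k) k ^+ 2.
      rewrite -[P _ _ ^+ 2]real_normK ?num_real//.
      rewrite -[A _ _ ^+ 2]real_normK ?num_real//.
      have := Ar k; have := normr_ge0 (P (r k) k); nra.
    have := w0 k; nra.
  exists (f v); split.
    by exists v => // k; rewrite /= in_itv/= mxE w0 wK.
  apply: eB; rewrite /ball/= sub0r normrN ger0_norm; last first.
    by apply: sumr_ge0 => i _; exact: sumr_ge0.
  apply: le_lt_trans GA; apply: ler_sum => i _; apply: ler_sum => j _.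
  rewrite -QA distrC -sumrB; apply: (le_trans (ler_norm_sum _ _ _)).
  apply: ler_sum => k _; rewrite -mulrBr mxE normrM ger0_norm//.
  by rewrite ler_wpM2r.
have : (f @` C) 0.
  (* The infimum 0 is attained because the continuous image of the compact box is closed. *)
  have : closed (f @` C).
    apply: compact_closed; first exact: Rhausdorff.
    by apply: continuous_compact => //; exact: continuous_subspaceT.
  by rewrite closure_id => ->.
move=> [w Cw fw0]; apply/is_scalableP.
exists (fun k => w 0 k) => [k|]; first by have := Cw k; rewrite /= in_itv/= => /andP[].
rewrite QE; apply/matrixP => i j; rewrite !mxE.
move: fw0 => /eqP; rewrite psumr_eq0 => [/allP/(_ i)|k _]; last exact: sumr_ge0.
rewrite mem_index_enum => /(_ isT) /=; rewrite psumr_eq0//.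
move=> /allP/(_ j); rewrite mem_index_enum => /(_ isT) /=.
by rewrite normr_eq0 subr_eq0 => /eqP.
Qed.

Unset Implicit Arguments.

Theorem theorem4p2 (R : realType) (N M : nat) (hN : (2 <= N)%N)
    (hNM : (N <= M)%N) (hM : (M < ((N - 1) * (N + 2)) %/ 2 + 1)%N) :
  [/\ (scalable_frames R M N)° = set0,
      scalable_frames R M N `<=` boundary (scalable_frames R M N) &
      boundary (scalable_frames R M N) `&` nonvanishing_frames R M N
        `<=` scalable_frames R M N].
Proof.
have noint : (scalable_frames R M N)° = set0.
  apply: scalable_no_interior; first exact: ltnW.
  (* After doubling, (N - 1)(N + 2) + 2 = N(N + 1), and the truncated division only needs its upper
     bound. *)
  apply: leq_trans hM _; rewrite -(leq_pmul2r (isT : 0 < 2)%N) card_upper_index.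
  rewrite mulnDl (leq_trans (leq_add (leq_trunc_div _ _) (leqnn _)))//.
  by nia.
split=> //.
  by move=> Phi SPhi; split; [exact: subset_closure|rewrite noint].
by move=> Phi [[clPhi _] nzPhi]; exact: closure_scalable.
Qed.
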